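(* Let $T\ge 1$ be an integer, let $U_T$ be the set of all $(a,b)\in\mathbb{R}^2$ such that the trinomial $z+az^{1+T}+bz^{1+2T}$ is univalent in the open unit disk $\mathbb{D}$, and let $C=(a^{(0)},b^{(0)})$ be the upper right corner of $U_T$, where $$a^{(0)}=2\,\frac{1+T}{1+2T}\,\sin\frac{\pi}{2+2T},\qquad b^{(0)}=\frac{1}{1+2T}.$$ Then the functions $L_1(x,y)=x$ and $L_2(x,y)=1+x+y$ attain their maximum over $U_T$ at the point $C$, and the function $L_3(x,y)=\dfrac{1-x+y}{1+x+y}$ attains its minimum over $U_T$ at the point $C$.
   Context: $\mathbb{D}=\{z\in\mathbb{C}:|z|<1\}$. A function is univalent in $\mathbb{D}$ if it is analytic and injective on $\mathbb{D}$. The ''upper right corner'' of $U_T$ is the point $C$ of the boundary of $U_T$ at which the horizontal boundary segment $$\Gamma_1=\left\{\left(t,\tfrac{1}{1+2T}\right):\ |t|\le 2\tfrac{1+T}{1+2T}\sin\tfrac{\pi}{2+2T}\right\}$$ meets the boundary arc $$\Gamma_3^{+}=\left\{(A(t),B(t)):\ t\in\left[0,\tfrac{\pi}{2+2T}\right]\right\},$$ where $$A(t)=\frac{2T\sin((2+2T)t)-(2+2T)\sin(2Tt)}{T\sin((2+3T)t)-(2+3T)\sin(Tt)},\qquad B(t)=\frac{T\sin((2+T)t)-(2+T)\sin(Tt)}{T\sin((2+3T)t)-(2+3T)\sin(Tt)}$$ (values at $t=0$ understood as limits); its coordinates are $(a^{(0)},b^{(0)})$. *)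

(* Defs.v *)
From Stdlib Require Import Reals Lra.
From Coquelicot Require Import Coquelicot.
Open Scope R_scope.

Definition unit_disk (z : C) : Prop := Cmod z < 1.

(* Analyticity on the open disk is complex differentiability at each point:
   [ex_derive] is taken over the normed field C. *)
Definition univalent (f : C -> C) : Prop :=
  (forall z : C, unit_disk z -> @ex_derive C_AbsRing C_NormedModule f z) /\
  (forall z w : C, unit_disk z -> unit_disk w -> f z = f w -> z = w).

Definition trinomial (T : nat) (a b : R) (z : C) : C :=
  (z + RtoC a * Cpow z (1 + T) + RtoC b * Cpow z (1 + 2 * T))%C.

Definition U (T : nat) (p : R * R) : Prop :=
  univalent (trinomial T (fst p) (snd p)).

Definition boundary (S : R * R -> Prop) (p : R * R) : Prop :=
  forall eps : posreal,
    (exists q : R * R, ball p eps q /\ S q) /\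
    (exists q : R * R, ball p eps q /\ ~ S q).

Definition a0 (T : nat) : R :=
  2 * ((1 + INR T) / (1 + 2 * INR T)) * sin (PI / (2 + 2 * INR T)).

Definition b0 (T : nat) : R := 1 / (1 + 2 * INR T).

Definition Gamma1 (T : nat) (p : R * R) : Prop :=
  exists t : R, Rabs t <= a0 T /\ p = (t, 1 / (1 + 2 * INR T)).

Definition Gamma3_den (T : nat) (t : R) : R :=
  INR T * sin ((2 + 3 * INR T) * t) - (2 + 3 * INR T) * sin (INR T * t).

Definition Gamma3_A (T : nat) (t : R) : R :=
  (2 * INR T * sin ((2 + 2 * INR T) * t)
     - (2 + 2 * INR T) * sin (2 * INR T * t)) / Gamma3_den T t.

Definition Gamma3_B (T : nat) (t : R) : R :=
  (INR T * sin ((2 + INR T) * t) - (2 + INR T) * sin (INR T * t))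
    / Gamma3_den T t.

(* The quotients [Gamma3_A] and [Gamma3_B] are 0 / 0 at t = 0, where the arc is
   defined by continuity. *)
Definition extend_at_0 (f : R -> R) (t : R) : R :=
  if Req_EM_T t 0 then real (Lim f 0) else f t.

Definition Gamma3_plus (T : nat) (p : R * R) : Prop :=
  exists t : R, 0 <= t <= PI / (2 + 2 * INR T) /\
    p = (extend_at_0 (Gamma3_A T) t, extend_at_0 (Gamma3_B T) t).

Definition upper_right_corner (T : nat) (p : R * R) : Prop :=
  boundary (U T) p /\ Gamma1 T p /\ Gamma3_plus T p.

Definition attains_max_at (S : R * R -> Prop) (L : R -> R -> R) (c : R * R)
  : Prop :=
  S c /\ forall p : R * R, S p -> L (fst p) (snd p) <= L (fst c) (snd c).

Definition attains_min_at (S : R * R -> Prop) (L : R -> R -> R) (c : R * R)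
  : Prop :=
  S c /\ forall p : R * R, S p -> L (fst c) (snd c) <= L (fst p) (snd p).

Definition L1 (x y : R) : R := x.
Definition L2 (x y : R) : R := 1 + x + y.
(* Stdlib division is total with [/ 0 = 0]; 1 + x + y > 0 on [U T] for T >= 1. *)
Definition L3 (x y : R) : R := (1 - x + y) / (1 + x + y).

(* Main.v *)
Require Import Defs.
From Stdlib Require Import Reals Lra Lia.
From Coquelicot Require Import Coquelicot.
Open Scope R_scope.

(** The region [U T] is an intersection of half-planes indexed by an angle
    [t] in ]0, PI[, namely [dieudonne_condition]: with
    [p = sin ((1 + T) t) / sin t] and [q = sin ((1 + 2 T) t) / sin t],
    univalence means [|b q| <= 1] and [|a p| <= 1 + b q] for every [t].
    Once this is known the extremal problem is linear.  Letting [t] tend to 0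
    gives [|b| <= b0 T]; taking [t = PI / (2 + 2 T)], where [p = 1 / s] and
    [q = 1] for [s = sin (PI / (2 + 2 T))], gives [|a| <= s (1 + b)].  Both are
    equalities at the corner, so that [a], [1 + a + b] and [a / (1 + b)] are
    maximal there, and [L3] is a decreasing function of [a / (1 + b)].

    The criterion comes from the factorization
    [f z - f (l z) = z (1 - l) D (l, z ^ T)], where [D] is quadratic in its
    second argument ([trinomial_minus_scaled]).  For [l] on the unit circle,
    [l = cis (2 t)], this quadratic is, up to a rotation of its argument, the
    real quadratic [1 + a p X + b q X^2], and the inequalities above say
    exactly that it has no zero in the disk.  Necessity
    ([univalent_dieudonne]) is then immediate.  Sufficiency
    ([dieudonne_univalent]) requires that [D (l, .)] has no zero in the disk
    for [|l| < 1] either.  For this, expand [1 / D (l, u) = sum h_n(l) u^n].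
    Each [h_n] is a polynomial in [l], bounded by [n + 1] on the circle
    because both reciprocal roots of the quadratic lie in the closed disk
    there.  Interpolation at roots of [-1] carries this inside the disk as
    [|h_n(l)| <= (n + 1) / (1 - |l|)] ([poly_disk_bound]).  A zero [u] of
    [D (l, .)] with [|u| < 1] would force geometric growth of [h_n(l)].

    Finally the corner must satisfy the criterion, which amounts to
    [(1 + T) s |sin ((1 + T) t)| <= T sin t + sin ((1 + T) t) cos (T t)]
    ([corner_inequality]).  Between two consecutive zeros of
    [sin ((1 + T) t)] the quotient of the two sides is monotone on each side
    of the midpoint, so it is enough to look at the midpoints, where the
    right-hand side is [(1 + T) sin t]. *)

(** * Complex differentiability of the trinomials *)

(** The two normed modules have the same norm but carry different uniform
    structures; product rules are stated for the one built from the absolute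
    value. *)
Lemma ex_derive_C_AbsRing (f : C -> C) (z : C) :
  @ex_derive C_AbsRing C_NormedModule f z <->
  @ex_derive C_AbsRing (AbsRing_NormedModule C_AbsRing) f z.
Proof.
split; intros [l [[H1 H2 [M [HM H3]]] H4]]; exists l;
  (split; [split; [exact H1|exact H2|exists M; split; [exact HM|exact H3]]|exact H4]).
Qed.

Lemma ex_derive_C_mult (f g : C -> C) (z : C) :
  @ex_derive C_AbsRing C_NormedModule f z ->
  @ex_derive C_AbsRing C_NormedModule g z ->
  @ex_derive C_AbsRing C_NormedModule (fun y => (f y * g y)%C) z.
Proof.
intros Hf Hg.
apply ex_derive_C_AbsRing in Hf; apply ex_derive_C_AbsRing in Hg; apply ex_derive_C_AbsRing.
destruct Hf as [lf Hf]; destruct Hg as [lg Hg].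
exists (lf * g z + f z * lg)%C.
refine (filterdiff_ext_lin _ _ _ (filterdiff_mult_fct (K:=C_AbsRing) (U:=AbsRing_NormedModule C_AbsRing) f g z _ _ Cmult_comm Hf Hg) _).
intros y. unfold scal; simpl. unfold plus, mult; simpl. ring.
Qed.
Lemma ex_derive_C_pow (n : nat) (z : C) :
  @ex_derive C_AbsRing C_NormedModule (fun y => Cpow y n) z.
Proof.
induction n as [|n IH].
- exact (@ex_derive_const C_AbsRing C_NormedModule (RtoC 1) z).
- apply ex_derive_C_mult; [|exact IH].
  apply ex_derive_C_AbsRing. exists (RtoC 1). exact (is_derive_id z).
Qed.
Lemma ex_derive_trinomial T a b (z : C) :
  @ex_derive C_AbsRing C_NormedModule (trinomial T a b) z.
Proof.
unfold trinomial.
apply (@ex_derive_plus C_AbsRing C_NormedModule (fun z => z + RtoC a * Cpow z (1 + T))%C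
  (fun z => RtoC b * Cpow z (1 + 2*T))%C).
apply (@ex_derive_plus C_AbsRing C_NormedModule (fun z => z)%C (fun z => RtoC a * Cpow z (1 + T))%C).
apply ex_derive_C_AbsRing. exists (RtoC 1). exact (is_derive_id z).
all: apply ex_derive_C_mult; [exact (@ex_derive_const C_AbsRing C_NormedModule _ z)|apply ex_derive_C_pow].
Qed.

(** * Polar form and roots in the unit disk *)

Definition cis (t : R) : C := (cos t, sin t).

Lemma cis_plus x y : cis (x + y) = (cis x * cis y)%C.
Proof.
unfold cis, Cmult; simpl. rewrite cos_plus, sin_plus. f_equal; ring.
Qed.

Lemma cis_0 : cis 0 = RtoC 1.
Proof. unfold cis. now rewrite cos_0, sin_0. Qed.

Lemma cis_pow n x : (cis x ^ n)%C = cis (INR n * x).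
Proof.
induction n as [|n IH].
- simpl. now rewrite Rmult_0_l, cis_0.
- rewrite Cpow_S, IH, <- cis_plus, S_INR. f_equal; ring.
Qed.

Lemma Cmod_cis x : Cmod (cis x) = 1.
Proof.
unfold Cmod, cis; simpl.
replace (cos x * (cos x * 1) + sin x * (sin x * 1)) with 1.
apply sqrt_1.
generalize (sin2_cos2 x); unfold Rsqr; lra.
Qed.

Lemma cis_neq_0 x : cis x <> RtoC 0.
Proof. apply Cmod_gt_0. rewrite Cmod_cis; lra. Qed.

Lemma cis_opp x : cis (- x) = (/ cis x)%C.
Proof.
assert (H : (cis x * cis (- x))%C = RtoC 1).
{ rewrite <- cis_plus, Rplus_opp_r. apply cis_0. }
replace (cis (- x)) with (/ cis x * (cis x * cis (- x)))%C.
rewrite H; ring.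
field. apply cis_neq_0.
Qed.

Lemma cis_minus_cis_opp x : (cis x - cis (- x))%C = (2 * Ci * RtoC (sin x))%C.
Proof.
unfold cis, Cminus, Cplus, Copp, Cmult, Ci, RtoC; simpl.
rewrite cos_neg, sin_neg. f_equal; ring.
Qed.

Lemma polar_form (u : C) :
  exists t, 0 <= t < 2 * PI /\ u = (RtoC (Cmod u) * cis t)%C.
Proof.
assert (HPI := PI_RGT_0).
destruct (Req_dec (Cmod u) 0) as [H0|H0].
{ exists 0. split; [lra|]. rewrite H0. rewrite (Cmod_eq_0 _ H0). ring. }
assert (Hp : 0 < Cmod u) by (generalize (Cmod_ge_0 u); lra).
assert (H2 := Cmod2_alt u). unfold Re, Im in H2.
set (r := Cmod u) in *.
set (x := fst u / r). set (y := snd u / r).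
assert (Hxy : x * x + y * y = 1).
{ unfold x, y.
  replace (fst u / r * (fst u / r) + snd u / r * (snd u / r))
    with ((fst u ^ 2 + snd u ^ 2) / r ^ 2) by (field; lra).
  rewrite <- H2. field; lra. }
assert (Hx : -1 <= x <= 1) by nra.
assert (Hc : cos (acos x) = x) by (apply cos_acos; lra).
assert (Hs : sin (acos x) * sin (acos x) = y * y).
{ generalize (sin2_cos2 (acos x)); unfold Rsqr; rewrite Hc; lra. }
assert (Hb := acos_bound x).
assert (Hs0 : 0 <= sin (acos x)) by (apply sin_ge_0; lra).
assert (Hu : u = (RtoC r * (x, y))%C).
{ rewrite (surjective_pairing u) at 1.
  unfold Cmult, RtoC, x, y; simpl. f_equal; field; lra. }
destruct (Rle_lt_dec 0 y) as [Hy|Hy].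
- exists (acos x). split; [lra|]. rewrite Hu at 1. f_equal. unfold cis.
  rewrite Hc. f_equal. nra.
- exists (2 * PI - acos x). split.
  { split; [lra|]. destruct (Req_dec (acos x) 0) as [E|E]; [|lra].
    rewrite E, sin_0 in Hs. nra. }
  rewrite Hu at 1. f_equal. unfold cis.
  replace (2 * PI - acos x) with (- acos x + 2 * INR 1 * PI) by (simpl; ring).
  rewrite cos_period, sin_period, cos_neg, sin_neg, Hc. f_equal. nra.
Qed.

Lemma exists_root_in_disk (n : nat) (u : C) :
  (1 <= n)%nat -> Cmod u < 1 -> exists z, Cmod z < 1 /\ (z ^ n)%C = u.
Proof.
intros Hn Hu.
assert (Hn' : 0 < INR n) by (apply lt_0_INR; lia).
destruct (Req_dec (Cmod u) 0) as [H0|H0].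
{ exists (RtoC 0). rewrite (Cmod_eq_0 _ H0), Cmod_0. split; [lra|].
  destruct n; [lia|]. rewrite Cpow_S. ring. }
assert (Hp : 0 < Cmod u) by (generalize (Cmod_ge_0 u); lra).
destruct (polar_form u) as [t [_ Ht]].
exists (RtoC (Rpower (Cmod u) (/ INR n)) * cis (t / INR n))%C.
split.
- rewrite Cmod_mult, Cmod_cis, Cmod_R, Rmult_1_r, Rabs_pos_eq.
  + unfold Rpower. rewrite <- exp_0. apply exp_increasing.
    assert (ln (Cmod u) < 0) by (rewrite <- ln_1; now apply ln_increasing).
    assert (0 < / INR n) by now apply Rinv_0_lt_compat. nra.
  + left; apply exp_pos.
- rewrite Cpow_mult_l, cis_pow, <- RtoC_pow, <- Rpower_pow by apply exp_pos.
  rewrite Rpower_mult, Rinv_l, Rpower_1 by lra.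
  rewrite Ht at 2. f_equal. f_equal. field; lra.
Qed.

(** * Real quadratics, the unit disk, and Lucas sequences *)

(** The quadratic is 1 at 0, so a value [<= 0] at [c] gives a root between 0 and
    [c]; the last hypothesis keeps that root off the unit circle. *)
Lemma quadratic_nonpos_root (al be c : R) :
  Rabs c <= 1 -> 1 + al * c + be * c * c <= 0 ->
  (Rabs c < 1 \/ 1 + al * c + be * c * c < 0) ->
  exists x, Rabs x < 1 /\ 1 + al * x + be * x * x = 0.
Proof.
intros Hc H1 H2.
set (f := fun s => - (1 + al * (c * s) + be * (c * s) * (c * s))).
assert (Hcont : continuity f) by (unfold f; reg).
destruct (IVT_cor f 0 1 Hcont) as [s [Hs Hfs]]; [lra| |].
{ unfold f. nra. }
exists (c * s). unfold f in Hfs. split; [|lra].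
rewrite Rabs_mult, (Rabs_pos_eq s) by lra.
assert (0 <= Rabs c) by apply Rabs_pos.
destruct H2 as [H2|H2]; [nra|].
destruct (Req_dec s 1) as [E|E]; [subst s; lra|nra].
Qed.

(** If [1 + be < |al|] the quadratic is negative at 1 or at -1.  Otherwise
    [be > 1], and the product [1 / be] of the roots is less than 1: conjugate
    roots both have squared modulus [1 / be], and in the real case the vertex
    [- al / (2 be)] lies in the disk and has a nonpositive value. *)
Lemma quadratic_root_in_disk (al be : R) :
  1 < Rabs be \/ 1 + be < Rabs al ->
  exists u : C, Cmod u < 1 /\ (1 + RtoC al * u + RtoC be * u ^ 2)%C = RtoC 0.
Proof.
intros H.
assert (real_case : (exists x, Rabs x < 1 /\ 1 + al * x + be * x * x = 0) ->
  exists u : C, Cmod u < 1 /\ (1 + RtoC al * u + RtoC be * u ^ 2)%C = RtoC 0).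
{ intros [x [H1 H2]]. exists (RtoC x). rewrite Cmod_R. split; [exact H1|].
  rewrite <- RtoC_pow, <- !RtoC_mult, <- !RtoC_plus. f_equal. rewrite <- H2. ring. }
destruct (Rlt_le_dec (1 + be) (Rabs al)) as [Ha|Ha].
{ apply real_case. destruct (Rle_lt_dec 0 al) as [Hs|Hs].
  - rewrite Rabs_pos_eq in Ha by lra.
    apply (quadratic_nonpos_root al be (-1)); [rewrite Rabs_left; lra|lra|lra].
  - rewrite Rabs_left in Ha by lra.
    apply (quadratic_nonpos_root al be 1); [rewrite Rabs_right; lra|lra|lra]. }
assert (Hb : 1 < be).
{ destruct H as [H|H]; [|lra]. assert (0 <= Rabs al) by apply Rabs_pos.
  unfold Rabs in H. destruct (Rcase_abs be); lra. }
destruct (Rle_lt_dec 0 (al * al - 4 * be)) as [Hd|Hd].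
- apply real_case.
  assert (Hc : Rabs (- al / (2 * be)) < 1).
  { unfold Rdiv. rewrite Rabs_mult, Rabs_Ropp, Rabs_inv, (Rabs_pos_eq (2 * be)) by lra.
    apply (Rmult_lt_reg_r (2 * be)); [lra|]. rewrite Rmult_assoc, Rinv_l by lra. lra. }
  apply (quadratic_nonpos_root al be (- al / (2 * be))); [lra| |now left].
  replace (1 + al * (- al / (2 * be)) + be * (- al / (2 * be)) * (- al / (2 * be)))
    with (- (al * al - 4 * be) * / (4 * be)) by (field; lra).
  assert (0 < / (4 * be)) by (apply Rinv_0_lt_compat; lra). nra.
- set (d := sqrt (4 * be - al * al)).
  assert (Hdd : d * d = 4 * be - al * al) by (apply sqrt_sqrt; lra).
  exists (- al / (2 * be), d / (2 * be)). split.
  + unfold Cmod.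
    apply (Rlt_le_trans _ (sqrt 1)); [apply sqrt_lt_1_alt; simpl|rewrite sqrt_1; lra].
    replace (- al / (2 * be) * (- al / (2 * be) * 1) + d / (2 * be) * (d / (2 * be) * 1))
      with (/ be * ((al * al + d * d) / (4 * be))) by (field; lra).
    rewrite Hdd. replace ((al * al + (4 * be - al * al)) / (4 * be)) with 1 by (field; lra).
    rewrite Rmult_1_r. split; [left; apply Rinv_0_lt_compat; lra|].
    rewrite <- Rinv_1. apply Rinv_lt_contravar; lra.
  + unfold Cpow, Cmult, Cplus, RtoC; simpl. f_equal; [|field; lra].
    transitivity ((4 * be - al * al - d * d) * / (4 * be)); [field; lra|].
    rewrite Hdd. ring.
Qed.

(** Together with [quadratic_root_in_disk] this is the Schur-Cohn test for real
    quadratics, here for the reversed quadratic [X^2 - al X + be]. *)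
Lemma quadratic_roots_in_closed_disk (al be : R) :
  Rabs be <= 1 -> Rabs al <= 1 + be ->
  exists x y : C, Cmod x <= 1 /\ Cmod y <= 1 /\
    (x + y)%C = RtoC al /\ (x * y)%C = RtoC be.
Proof.
intros Hb Ha.
assert (Hb2 : -1 <= be <= 1) by (apply Rabs_le_between; exact Hb).
assert (Ha2 : - (1 + be) <= al <= 1 + be) by (apply Rabs_le_between; exact Ha).
destruct (Rle_lt_dec 0 (al * al - 4 * be)) as [Hd|Hd].
- set (d := sqrt (al * al - 4 * be)).
  assert (Hdd : d * d = al * al - 4 * be) by (apply sqrt_sqrt; lra).
  assert (Hd0 : 0 <= d) by apply sqrt_pos.
  assert (d <= 2 - al) by nra. assert (d <= 2 + al) by nra.
  exists (RtoC ((al + d) / 2)), (RtoC ((al - d) / 2)).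
  rewrite !Cmod_R, <- RtoC_plus, <- RtoC_mult.
  repeat split; [apply Rabs_le; lra|apply Rabs_le; lra|f_equal; field|f_equal; nra].
- set (d := sqrt (4 * be - al * al)).
  assert (Hdd : d * d = 4 * be - al * al) by (apply sqrt_sqrt; lra).
  assert (Hm : forall e, e * e = d * d -> Cmod (al / 2, e / 2) <= 1).
  { intros e He. unfold Cmod.
    apply (Rle_trans _ (sqrt 1)); [apply sqrt_le_1_alt; simpl; nra|rewrite sqrt_1; lra]. }
  exists (al / 2, d / 2), (al / 2, - d / 2).
  repeat split; [apply Hm; ring|apply Hm; ring| |];
    unfold Cplus, Cmult, RtoC; simpl; f_equal; nra.
Qed.

(** The power series coefficients of [1 / (1 - s u + p u^2)].  If [s = x + y]
    and [p = x * y], the n-th one is the complete homogeneous symmetric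
    polynomial of degree [n] in [x] and [y]. *)
Fixpoint lucas (s p : C) (n : nat) : C :=
  match n with
  | O => 1
  | S m => match m with
           | O => s
           | S k => s * lucas s p m - p * lucas s p k
           end
  end%C.

Lemma lucas_SS s p n :
  lucas s p (S (S n)) = (s * lucas s p (S n) - p * lucas s p n)%C.
Proof. reflexivity. Qed.

Lemma nat_two_step_ind (P : nat -> Prop) :
  P 0%nat -> P 1%nat -> (forall n, P n -> P (S n) -> P (S (S n))) -> forall n, P n.
Proof.
intros H0 H1 H n. assert (P n /\ P (S n)) by (induction n; intuition auto). tauto.
Qed.

Lemma lucas_scale c s p n :
  lucas (c * s) (c ^ 2 * p) n = (c ^ n * lucas s p n)%C.
Proof.
induction n as [| |n IH1 IH2] using nat_two_step_ind; [simpl; ring|simpl; ring|].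
rewrite !lucas_SS, IH1, IH2, !Cpow_S. ring.
Qed.

Lemma lucas_step x y n :
  (lucas (x + y) (x * y) (S n) - y * lucas (x + y) (x * y) n)%C = (x ^ S n)%C.
Proof.
induction n as [|n IH]; [simpl; ring|].
rewrite lucas_SS, Cpow_S, <- IH. ring.
Qed.

Lemma lucas_bound x y n : Cmod x <= 1 -> Cmod y <= 1 ->
  Cmod (lucas (x + y) (x * y) n) <= INR n + 1.
Proof.
intros Hx Hy. induction n as [|n IH]; [simpl; rewrite Cmod_1; lra|].
replace (lucas (x + y) (x * y) (S n))
  with (y * lucas (x + y) (x * y) n + x ^ S n)%C by (rewrite <- (lucas_step x y n); ring).
eapply Rle_trans; [apply Cmod_triangle|].
rewrite Cmod_mult, Cmod_pow, S_INR.
assert (Cmod x ^ S n <= 1).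
{ rewrite <- (pow1 (S n)). apply pow_incr. split; [apply Cmod_ge_0|exact Hx]. }
assert (0 <= Cmod y) by apply Cmod_ge_0.
assert (0 <= Cmod (lucas (x + y) (x * y) n)) by apply Cmod_ge_0.
nra.
Qed.

(** The square of Bernoulli's lower bound for [r ^ (n + 1)] grows
    quadratically in [n]. *)
Lemma geometric_beats_linear r K :
  1 < r -> ~ (forall n : nat, r ^ S n <= K * (INR n + 2)).
Proof.
intros Hr H.
assert (B : forall n, 1 + INR n * (r - 1) <= r ^ n).
{ intros n. assert (B := poly n (r - 1)). replace (1 + (r - 1)) with r in B by ring.
  apply B; lra. }
(* At exponent 2 n + 2 the hypothesis reads A * A <= K * (2 n + 3), while
   A * A > (n + 1)^2 x^2 >= 4 K (n + 1) as soon as n x^2 > 4 K. *)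
set (x := r - 1) in *. assert (Hx : 0 < x) by (unfold x; lra).
destruct (INR_archimed (x * x) (4 * K)) as [n Hn]; [nra|].
assert (Hn0 := pos_INR n).
specialize (B (S n)). rewrite S_INR in B.
specialize (H (S (2 * n))).
replace (S (S (2 * n))) with (S n + S n)%nat in H by lia.
rewrite pow_add, S_INR, mult_INR in H. replace (INR 2) with 2 in H by reflexivity.
set (N := INR n) in *. set (A := r ^ S n) in *.
assert (HA : 1 + (N + 1) * x <= A) by exact B.
assert (HN : 0 <= (N + 1) * x) by nra.
assert (HAA : ((N + 1) * x) * ((N + 1) * x) < A * A) by nra.
assert (HK : 0 < K) by nra.
assert (4 * K * (N + 1) <= ((N + 1) * x) * ((N + 1) * x)).
{ replace (((N + 1) * x) * ((N + 1) * x)) with ((N + 1) * ((N + 1) * (x * x))) by ring.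
  rewrite (Rmult_comm (4 * K)). apply Rmult_le_compat_l; nra. }
nra.
Qed.

(** * A maximum principle for polynomials *)

Lemma Cmult_eq_0_reg_l (a b : C) : a <> RtoC 0 -> (a * b)%C = RtoC 0 -> b = RtoC 0.
Proof.
intros Ha H. replace b with (/ a * (a * b))%C by now field. rewrite H. ring.
Qed.

Definition csum (f : nat -> C) (n : nat) : C := @sum_n C_AbelianGroup f n.

Lemma csum_S f n : csum f (S n) = (csum f n + f (S n))%C.
Proof. exact (sum_Sn f n). Qed.

Lemma csum_0 f : csum f 0 = f 0%nat.
Proof. exact (sum_O f). Qed.

Lemma csum_ext f g n : (forall k, (k <= n)%nat -> f k = g k) -> csum f n = csum g n.
Proof. exact (sum_n_ext_loc f g n). Qed.

Lemma csum_plus f g n : csum (fun k => f k + g k)%C n = (csum f n + csum g n)%C.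
Proof. exact (sum_n_plus f g n). Qed.

Lemma csum_mult_l c f n : csum (fun k => c * f k)%C n = (c * csum f n)%C.
Proof. exact (@sum_n_mult_l C_Ring c f n). Qed.

Lemma csum_switch (f : nat -> nat -> C) m n :
  csum (fun i => csum (f i) n) m = csum (fun j => csum (fun i => f i j) m) n.
Proof. exact (sum_n_switch f m n). Qed.

Lemma csum_zero f n : (forall k, (k <= n)%nat -> f k = RtoC 0) -> csum f n = RtoC 0.
Proof.
induction n as [|n IH]; intros H; [rewrite csum_0; apply H; lia|].
rewrite csum_S, IH, H by (auto with arith). ring.
Qed.

Lemma csum_single f n k : (k <= n)%nat ->
  (forall i, (i <= n)%nat -> i <> k -> f i = RtoC 0) -> csum f n = f k.
Proof.
induction n as [|n IH]; intros Hk H.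
{ rewrite csum_0. f_equal; lia. }
rewrite csum_S. destruct (Nat.eq_dec k (S n)) as [->|E].
- rewrite csum_zero; [ring|]. intros i Hi. apply H; lia.
- rewrite IH, (H (S n)); [ring|lia|lia|lia|]. intros i Hi. apply H; lia.
Qed.

Lemma Cmod_csum_le f (g : nat -> R) n : (forall k, (k <= n)%nat -> Cmod (f k) <= g k) ->
  Cmod (csum f n) <= sum_n g n.
Proof.
induction n as [|n IH]; intros H.
{ rewrite csum_0, sum_O. now apply H. }
rewrite csum_S, sum_Sn. eapply Rle_trans; [apply Cmod_triangle|].
apply Rplus_le_compat; [apply IH; intros; apply H; lia|now apply H].
Qed.

Lemma geometric_csum l n : ((1 - l) * csum (fun k => l ^ k)%C n)%C = (1 - l ^ S n)%C.
Proof.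
induction n as [|n IH]; [rewrite csum_0; simpl; ring|].
rewrite csum_S, Cmult_plus_distr_l, IH, !Cpow_S. ring.
Qed.

Lemma geometric_sum_le r n : 0 <= r < 1 -> sum_n (fun k => r ^ k) n <= / (1 - r).
Proof.
intros Hr. rewrite sum_n_Reals, tech3 by lra. unfold Rdiv.
rewrite <- (Rmult_1_l (/ (1 - r))) at 2. apply Rmult_le_compat_r.
- left. apply Rinv_0_lt_compat; lra.
- assert (0 <= r ^ S n) by (apply pow_le; lra). lra.
Qed.

(** Polynomial functions of degree at most [N], as a span of monomials: a
    property that is linear in the polynomial needs checking on monomials
    only.  The last rule makes the predicate invariant under pointwise
    equality without assuming functional extensionality. *)
Inductive poly_deg (N : nat) : (C -> C) -> Prop :=
| poly_zero : poly_deg N (fun _ => RtoC 0)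
| poly_add_monomial c k p : (k <= N)%nat -> poly_deg N p ->
    poly_deg N (fun l => c * l ^ k + p l)%C
| poly_ext p q : (forall l, p l = q l) -> poly_deg N p -> poly_deg N q.

Lemma poly_plus N p q : poly_deg N p -> poly_deg N q -> poly_deg N (fun l => p l + q l)%C.
Proof.
intros Hp Hq. induction Hp as [|c k p Hk Hp IH|p p' E Hp IH].
- apply (poly_ext N q); [intros l; ring|exact Hq].
- apply (poly_ext N (fun l => c * l ^ k + (p l + q l))%C); [intros l; ring|].
  now apply poly_add_monomial.
- apply (poly_ext N (fun l => p l + q l)%C); [intros l; now rewrite E|exact IH].
Qed.

Lemma poly_mult_monomial N M c k p : (k <= M)%nat -> poly_deg N p ->
  poly_deg (M + N) (fun l => (c * l ^ k) * p l)%C.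
Proof.
intros Hk Hp. induction Hp as [|d j p Hj Hp IH|p p' E Hp IH].
- apply (poly_ext _ (fun _ => RtoC 0)); [intros l; ring|apply poly_zero].
- apply (poly_ext _ (fun l => (c * d) * l ^ (k + j) + (c * l ^ k) * p l)%C).
  + intros l. rewrite Cpow_add_r. ring.
  + apply poly_add_monomial; [lia|exact IH].
- apply (poly_ext _ (fun l => (c * l ^ k) * p l)%C); [intros l; now rewrite E|exact IH].
Qed.

Lemma poly_mult N M p q : poly_deg N p -> poly_deg M q ->
  poly_deg (N + M) (fun l => p l * q l)%C.
Proof.
intros Hp Hq. induction Hp as [|c k p Hk Hp IH|p p' E Hp IH].
- apply (poly_ext _ (fun _ => RtoC 0)); [intros l; ring|apply poly_zero].
- apply (poly_ext _ (fun l => (c * l ^ k) * q l + p l * q l)%C); [intros l; ring|].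
  apply poly_plus; [now apply poly_mult_monomial|exact IH].
- apply (poly_ext _ (fun l => p l * q l)%C); [intros l; now rewrite E|exact IH].
Qed.

Lemma poly_weaken N M p : (N <= M)%nat -> poly_deg N p -> poly_deg M p.
Proof.
intros H Hp. induction Hp as [|c k p Hk Hp IH|p p' E Hp IH].
- apply poly_zero.
- apply poly_add_monomial; [lia|exact IH].
- now apply (poly_ext _ p).
Qed.

Lemma poly_const N c : poly_deg N (fun _ => c).
Proof.
apply (poly_ext _ (fun l => c * l ^ 0 + 0)%C); [intros l; simpl; ring|].
apply poly_add_monomial; [lia|apply poly_zero].
Qed.

Lemma poly_geometric n : poly_deg n (fun l => csum (fun k => l ^ k)%C n).
Proof.
assert (H : forall m, (m <= n)%nat -> poly_deg n (fun l => csum (fun k => l ^ k)%C m)).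
{ induction m as [|m IH]; intros Hm.
  - apply (poly_ext _ (fun _ => RtoC 1)); [intros l; now rewrite csum_0|apply poly_const].
  - apply (poly_ext _ (fun l => 1 * l ^ S m + csum (fun k => l ^ k)%C m)%C).
    + intros l. rewrite csum_S. ring.
    + apply poly_add_monomial; [lia|apply IH; lia]. }
apply H; lia.
Qed.

(** The nodes are the [N + 1] roots of [X^(N+1) = -1].  Roots of -1 rather than
    of 1 are used in order to avoid the point 1, where the trigonometric
    quotients of the criterion become 0 / 0. *)
Definition node_angle (N j : nat) : R := (2 * INR j + 1) * PI / (2 * (INR N + 1)).
Definition node (N j : nat) : C := cis (2 * node_angle N j).

Lemma node_angle_bounds N j : (j <= N)%nat -> 0 < node_angle N j < PI.
Proof.
intros Hj. assert (HPI := PI_RGT_0). apply le_INR in Hj.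
assert (Hj0 := pos_INR j). unfold node_angle, Rdiv.
assert (Hi : 0 < / (2 * (INR N + 1))) by (apply Rinv_0_lt_compat; lra).
split.
- apply Rmult_lt_0_compat; [nra|exact Hi].
- apply (Rmult_lt_reg_r (2 * (INR N + 1))); [lra|].
  rewrite Rmult_assoc, Rinv_l by lra. nra.
Qed.

Lemma cis_double_neq_1 x : - PI < x < PI -> x <> 0 -> cis (2 * x) <> RtoC 1.
Proof.
intros Hx H0 E. injection E as Ec Es.
rewrite cos_2a_sin in Ec.
assert (Hs : sin x = 0) by nra.
destruct (Rlt_le_dec x 0) as [H|H].
- assert (0 < sin (- x)) by (apply sin_gt_0; lra). rewrite sin_neg in *. lra.
- assert (0 < sin x) by (apply sin_gt_0; lra). lra.
Qed.

(** The summands form a geometric progression whose ratio [cis (2 x)] is an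
    [N+1]-st root of unity, different from 1 because [0 < |k - l| <= N]. *)
Lemma node_orthogonality N k l : (k <= N)%nat -> (l <= N)%nat -> k <> l ->
  csum (fun j => node N j ^ k * (/ node N j) ^ l)%C N = RtoC 0.
Proof.
intros Hk Hl Hkl. assert (HPI := PI_RGT_0).
set (x := (INR k - INR l) * PI / (INR N + 1)).
assert (HN := pos_INR N).
rewrite (csum_ext _ (fun j => cis x * cis (2 * x) ^ j)%C).
2:{ intros j _. unfold node. rewrite <- cis_opp, !cis_pow, <- !cis_plus. f_equal.
    unfold x, node_angle. field. lra. }
rewrite csum_mult_l.
assert (Hne : cis (2 * x) <> RtoC 1).
{ assert (INR k <> INR l) by now apply not_INR.
  assert (Hk' := le_INR _ _ Hk). assert (Hl' := le_INR _ _ Hl).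
  assert (Hk0 := pos_INR k). assert (Hl0 := pos_INR l).
  assert (Hx : x * (INR N + 1) = (INR k - INR l) * PI) by (unfold x; field; lra).
  apply cis_double_neq_1; [split; nra|]. intros E. rewrite E in Hx. nra. }
assert (Hg := geometric_csum (cis (2 * x)) N).
assert (Hp : (cis (2 * x) ^ S N)%C = RtoC 1).
{ rewrite cis_pow, S_INR.
  replace ((INR N + 1) * (2 * x)) with (2 * (INR k * PI) + - (2 * (INR l * PI)))
    by (unfold x; field; lra).
  assert (P : forall i, cis (2 * (INR i * PI)) = RtoC 1).
  { intros i. rewrite <- cis_0. unfold cis. f_equal.
    - rewrite <- (cos_period 0 i). f_equal; ring.
    - rewrite <- (sin_period 0 i). f_equal; ring. }
  rewrite cis_plus, cis_opp, !P. field. }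
rewrite Hp in Hg.
assert (H0 : csum (fun j => cis (2 * x) ^ j)%C N = RtoC 0).
{ apply (Cmult_eq_0_reg_l (1 - cis (2 * x))%C).
  - intros E. apply Hne.
    replace (cis (2 * x)) with (1 - (1 - cis (2 * x)))%C by ring. rewrite E. ring.
  - rewrite Hg. ring. }
transitivity (cis x * 0)%C; [exact (f_equal (Cmult (cis x)) H0)|ring].
Qed.

(** Discrete Cauchy formula: the inner sum plays the role of the Cauchy kernel
    [1 / (1 - l / node)], truncated at the degree of [p]. *)
Lemma node_interpolation N p (l : C) : poly_deg N p ->
  (RtoC (INR N + 1) * p l)%C =
  csum (fun j => p (node N j) * csum (fun i => (l * / node N j) ^ i)%C N)%C N.
Proof.
intros Hp. induction Hp as [|c k p Hk Hp IH|p p' E Hp IH].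
- rewrite csum_zero; [ring|]. intros; ring.
- rewrite (csum_ext _ (fun j =>
    c * (csum (fun i => l ^ i * (node N j ^ k * (/ node N j) ^ i)) N)
    + p (node N j) * csum (fun i => (l * / node N j) ^ i) N)%C).
  2:{ intros j _. rewrite Cmult_plus_distr_r. f_equal. rewrite <- Cmult_assoc. f_equal.
      rewrite <- csum_mult_l. apply csum_ext. intros i _. rewrite Cpow_mult_l. ring. }
  rewrite csum_plus, <- IH, csum_mult_l, csum_switch.
  rewrite (csum_single _ N k Hk).
  + rewrite (csum_ext _ (fun j => l ^ k * 1)%C).
    2:{ intros j _. f_equal. rewrite <- Cpow_mult_l, Cinv_r by apply cis_neq_0.
        apply Cpow_1_l. }
    rewrite csum_mult_l.
    assert (H1 : forall n, csum (fun _ => RtoC 1) n = RtoC (INR n + 1)).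
    { induction n as [|n IHn]; [rewrite csum_0; f_equal; simpl; ring|].
      rewrite csum_S, IHn, S_INR, <- RtoC_plus. reflexivity. }
    rewrite H1. ring.
  + intros i Hi Hik. rewrite csum_mult_l, node_orthogonality by (auto; lia). ring.
- rewrite <- E, IH. apply csum_ext. intros j _. now rewrite E.
Qed.

(** This falls short of the maximum modulus principle by the factor
    [1 / (1 - |l|)].  The factor does not depend on the polynomial, which is
    harmless when the bound is applied to a whole sequence of polynomials. *)
Lemma poly_disk_bound N p (M : R) (l : C) : poly_deg N p ->
  (forall t, 0 < t < PI -> Cmod (p (cis (2 * t))) <= M) -> Cmod l < 1 ->
  Cmod (p l) <= M / (1 - Cmod l).
Proof.
intros Hp HM Hl. assert (HN := pos_INR N).
assert (Hr : 0 <= Cmod l < 1) by (split; [apply Cmod_ge_0|exact Hl]).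
assert (H : Cmod (RtoC (INR N + 1) * p l) <= sum_n (fun _ => M / (1 - Cmod l)) N).
{ rewrite (node_interpolation N p l Hp). apply Cmod_csum_le. intros j Hj.
  rewrite Cmod_mult. unfold Rdiv. apply Rmult_le_compat; try apply Cmod_ge_0.
  - apply HM. now apply node_angle_bounds.
  - eapply Rle_trans; [|apply (geometric_sum_le _ N Hr)].
    apply Cmod_csum_le. intros i _.
    unfold node. rewrite Cmod_pow, Cmod_mult, Cmod_inv, Cmod_cis by apply cis_neq_0.
    right. f_equal. field. }
rewrite Cmod_mult, Cmod_R, Rabs_pos_eq, sum_n_const, S_INR in H by lra.
apply (Rmult_le_reg_l (INR N + 1)); [lra|exact H].
Qed.

(** * A criterion for univalence *)

(** By the Schur-Cohn test, Dieudonne's criterion for [trinomial T a b]: the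
    quadratic [sin t + a sin ((1+T) t) X + b sin ((1+2T) t) X^2] has no zero in
    the open unit disk. *)
Definition dieudonne_condition (T : nat) (a b : R) : Prop :=
  forall t, 0 < t < PI ->
    Rabs (b * sin ((1 + 2 * INR T) * t)) <= sin t /\
    Rabs (a * sin ((1 + INR T) * t)) <= sin t + b * sin ((1 + 2 * INR T) * t).

Definition geom (n : nat) (l : C) : C := csum (fun k => l ^ k)%C n.

(** On the circle the geometric sum is a Dirichlet kernel times a phase. *)
Lemma geom_cis n t : sin t <> 0 ->
  geom n (cis (2 * t)) = (cis t ^ n * RtoC (sin ((1 + INR n) * t) / sin t))%C.
Proof.
intros Hs.
assert (F : forall x, (1 - cis (2 * x))%C = (- (2 * Ci * RtoC (sin x)) * cis x)%C).
{ intros x. rewrite <- cis_minus_cis_opp.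
  replace (2 * x) with (x + x) by ring. rewrite cis_plus, cis_opp. field. apply cis_neq_0. }
assert (Hne : (1 - cis (2 * t))%C <> RtoC 0).
{ rewrite F. intros E. apply (f_equal Cmod) in E.
  rewrite Cmod_mult, Cmod_opp, !Cmod_mult, Cmod_cis, Cmod_Ci, !Cmod_R, Rabs_R0 in E.
  assert (0 < Rabs (sin t)) by now apply Rabs_pos_lt.
  rewrite (Rabs_pos_eq 2) in E by lra. lra. }
assert (G : ((1 - cis (2 * t)) * geom n (cis (2 * t)))%C =
  ((1 - cis (2 * t)) * (cis t ^ n * RtoC (sin ((1 + INR n) * t) / sin t)))%C).
{ unfold geom. rewrite geometric_csum, cis_pow, S_INR.
  replace ((INR n + 1) * (2 * t)) with (2 * ((1 + INR n) * t)) by ring.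
  rewrite !F.
  replace ((1 + INR n) * t) with (t + INR n * t) at 2 by ring.
  rewrite cis_plus, <- cis_pow, RtoC_div by exact Hs.
  field. intros E. apply Hs. now injection E. }
replace (geom n (cis (2 * t)))
  with (/ (1 - cis (2 * t)) * ((1 - cis (2 * t)) * geom n (cis (2 * t))))%C by now field.
rewrite G. field. exact Hne.
Qed.

(** [(f z - f (l z)) / (z - l z)] as a function of [l] and [u = z^T]. *)
Definition divided_difference (T : nat) (a b : R) (l u : C) : C :=
  (1 + RtoC a * geom T l * u + RtoC b * geom (2 * T) l * u ^ 2)%C.

Lemma trinomial_minus_scaled T a b z l :
  (trinomial T a b z - trinomial T a b (l * z))%C =
  (z * (1 - l) * divided_difference T a b l (z ^ T))%C.
Proof.
unfold divided_difference, trinomial.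
assert (G : forall n, ((1 - l) * geom n l)%C = (1 - l ^ S n)%C)
  by (intros n; apply geometric_csum).
replace (z * (1 - l) * (1 + RtoC a * geom T l * z ^ T + RtoC b * geom (2 * T) l * (z ^ T) ^ 2))%C
  with (z * (1 - l) + RtoC a * ((1 - l) * geom T l) * (z * z ^ T)
        + RtoC b * ((1 - l) * geom (2 * T) l) * (z * (z ^ T) ^ 2))%C by ring.
rewrite !G.
change (1 + T)%nat with (S T). change (1 + 2 * T)%nat with (S (2 * T)).
rewrite !Cpow_mult_l, <- Cpow_mult_r, !Cpow_S, (Nat.mul_comm T 2). ring.
Qed.

Lemma divided_difference_cis T a b t w : sin t <> 0 ->
  divided_difference T a b (cis (2 * t)) w =
  (1 + RtoC (a * (sin ((1 + INR T) * t) / sin t)) * (cis t ^ T * w)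
     + RtoC (b * (sin ((1 + 2 * INR T) * t) / sin t)) * (cis t ^ T * w) ^ 2)%C.
Proof.
intros Hs. unfold divided_difference. rewrite !geom_cis by exact Hs.
replace (INR (2 * T)) with (2 * INR T) by (rewrite mult_INR; reflexivity).
rewrite (Nat.mul_comm 2 T), Cpow_mult_r, !RtoC_mult. ring.
Qed.

(** If the quadratic attached to [t] vanishes at [u] in the disk and
    [z^T = u], then [f] takes the same value at [z * cis t] and at
    [z * cis (- t)]. *)
Lemma univalent_dieudonne T a b : (1 <= T)%nat ->
  U T (a, b) -> dieudonne_condition T a b.
Proof.
intros HT [_ Hinj] t Ht. simpl in Hinj.
assert (Hs : 0 < sin t) by (apply sin_gt_0; lra).
set (p := sin ((1 + INR T) * t) / sin t).
set (q := sin ((1 + 2 * INR T) * t) / sin t).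
assert (Hno : ~ (1 < Rabs (b * q) \/ 1 + b * q < Rabs (a * p))).
{ intros H. destruct (quadratic_root_in_disk _ _ H) as [u [Hu Hroot]].
  destruct (exists_root_in_disk T u HT Hu) as [z [Hz HzT]].
  set (w := (z * cis (- t))%C).
  (* The second point z * cis t is cis (2 * t) * w. *)
  assert (Hw : (cis t ^ T * w ^ T)%C = u).
  { rewrite <- Cpow_mult_l, <- HzT. f_equal. unfold w. rewrite cis_opp.
    field. apply cis_neq_0. }
  assert (Hwm : Cmod w < 1) by (unfold w; rewrite Cmod_mult, Cmod_cis; lra).
  assert (E := trinomial_minus_scaled T a b w (cis (2 * t))).
  rewrite divided_difference_cis, Hw in E by lra. fold p q in E.
  rewrite Hroot, Cmult_0_r in E.
  assert (Heq : w = (cis (2 * t) * w)%C).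
  { apply Hinj; unfold unit_disk.
    - exact Hwm.
    - rewrite Cmod_mult, Cmod_cis; lra.
    - replace (trinomial T a b w) with (trinomial T a b w - trinomial T a b (cis (2 * t) * w)
        + trinomial T a b (cis (2 * t) * w))%C by ring.
      rewrite E. ring. }
  assert (Hw0 : w = RtoC 0).
  { apply (Cmult_eq_0_reg_l (1 - cis (2 * t))%C).
    - intros E1. apply (cis_double_neq_1 t); [lra|lra|].
      replace (cis (2 * t)) with (1 - (1 - cis (2 * t)))%C by ring. rewrite E1. ring.
    - replace ((1 - cis (2 * t)) * w)%C with (w - cis (2 * t) * w)%C by ring.
      rewrite <- Heq. ring. }
  assert (Hu0 : u = RtoC 0).
  { rewrite <- Hw, Hw0. destruct T; [lia|]. rewrite (Cpow_S 0). ring. }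
  rewrite Hu0 in Hroot. apply (f_equal Re) in Hroot. simpl in Hroot. lra. }
assert (H1 : Rabs (b * q) <= 1) by (apply Rnot_lt_le; tauto).
assert (H2 : Rabs (a * p) <= 1 + b * q) by (apply Rnot_lt_le; tauto).
replace (b * sin ((1 + 2 * INR T) * t)) with (b * q * sin t) by (unfold q; field; lra).
replace (a * sin ((1 + INR T) * t)) with (a * p * sin t) by (unfold p; field; lra).
rewrite (Rabs_mult (b * q)), (Rabs_mult (a * p)), (Rabs_pos_eq (sin t)) by lra.
split; nra.
Qed.

Definition polynomial (p : C -> C) : Prop := exists N, poly_deg N p.

Lemma polynomial_lucas s p n : polynomial s -> polynomial p ->
  polynomial (fun l => lucas (s l) (p l) n).
Proof.
intros [N Hs] [M Hp]. induction n as [| |n [N1 IH1] [N2 IH2]] using nat_two_step_ind.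
- exists 0%nat. exact (poly_const 0 1).
- exists N. exact Hs.
- exists (max (N + N2) (0 + (M + N1)))%nat.
  apply (poly_ext _ (fun l => s l * lucas (s l) (p l) (S n)
      + RtoC (-1) * (p l * lucas (s l) (p l) n))%C).
  + intros l. rewrite lucas_SS. ring.
  + apply poly_plus.
    * apply (poly_weaken (N + N2)); [lia|]. now apply poly_mult.
    * apply (poly_weaken (0 + (M + N1))); [lia|].
      apply poly_mult; [apply poly_const|now apply poly_mult].
Qed.

(** Sum and product of the roots [v] of [v^2 D (l, 1 / v)], where
    [D = divided_difference T a b]. *)
Definition reciprocal_roots_sum (T : nat) (a : R) (l : C) : C := (RtoC (- a) * geom T l)%C.
Definition reciprocal_roots_prod (T : nat) (b : R) (l : C) : C := (RtoC b * geom (2 * T) l)%C.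

(** At [l = cis (2 t)] the reciprocal roots are those of a real quadratic,
    multiplied by [cis t ^ T]; the condition puts them in the closed disk. *)
Lemma lucas_bound_circle T a b t n : dieudonne_condition T a b -> 0 < t < PI ->
  Cmod (lucas (reciprocal_roots_sum T a (cis (2 * t))) (reciprocal_roots_prod T b (cis (2 * t))) n) <= INR n + 1.
Proof.
intros H Ht. destruct (H t Ht) as [H1 H2].
assert (Hs : 0 < sin t) by (apply sin_gt_0; lra).
set (p := sin ((1 + INR T) * t) / sin t).
set (q := sin ((1 + 2 * INR T) * t) / sin t).
replace (b * sin ((1 + 2 * INR T) * t)) with (b * q * sin t) in * by (unfold q; field; lra).
replace (a * sin ((1 + INR T) * t)) with (a * p * sin t) in * by (unfold p; field; lra).
rewrite (Rabs_mult (b * q)), (Rabs_pos_eq (sin t)) in H1 by lra.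
rewrite (Rabs_mult (a * p)), (Rabs_pos_eq (sin t)) in H2 by lra.
destruct (quadratic_roots_in_closed_disk (- (a * p)) (b * q)) as [x [y [Hx [Hy [Hxy1 Hxy2]]]]].
{ nra. } { rewrite Rabs_Ropp; nra. }
unfold reciprocal_roots_sum, reciprocal_roots_prod. rewrite !geom_cis by lra.
replace (INR (2 * T)) with (2 * INR T) by (rewrite mult_INR; reflexivity).
fold p q.
replace (RtoC (- a) * (cis t ^ T * RtoC p))%C with (cis t ^ T * (x + y))%C
  by (rewrite Hxy1, !RtoC_opp, RtoC_mult; ring).
replace (RtoC b * (cis t ^ (2 * T) * RtoC q))%C with ((cis t ^ T) ^ 2 * (x * y))%C
  by (rewrite Hxy2, RtoC_mult, <- Cpow_mult_r, (Nat.mul_comm T 2); ring).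
rewrite lucas_scale, Cmod_mult, !Cmod_pow, Cmod_cis, !pow1, Rmult_1_l.
now apply lucas_bound.
Qed.

Lemma lucas_growth_closed_disk T a b l : dieudonne_condition T a b ->
  Cmod l <= 1 -> l <> RtoC 1 ->
  exists K, 0 <= K /\ forall n, Cmod (lucas (reciprocal_roots_sum T a l) (reciprocal_roots_prod T b l) n) <= K * (INR n + 1).
Proof.
intros H Hl Hl1.
destruct (Rle_lt_or_eq_dec _ _ Hl) as [Hlt|Heq].
- exists (/ (1 - Cmod l)). split.
  { left. apply Rinv_0_lt_compat. lra. }
  intros n.
  assert (P : polynomial (fun l => lucas (reciprocal_roots_sum T a l) (reciprocal_roots_prod T b l) n)).
  { apply polynomial_lucas; [exists (0 + T)%nat|exists (0 + 2 * T)%nat];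
      (apply poly_mult; [apply poly_const|apply poly_geometric]). }
  destruct P as [N P].
  rewrite Rmult_comm. apply (poly_disk_bound N _ _ l P); [|exact Hlt].
  intros t Ht. now apply lucas_bound_circle.
- exists 1. split; [lra|]. intros n. rewrite Rmult_1_l.
  destruct (polar_form l) as [x [Hx E]]. rewrite Heq, Cmult_1_l in E.
  assert (Hx0 : x <> 0) by (intros ->; apply Hl1; rewrite E; apply cis_0).
  replace x with (2 * (x / 2)) in E by field. rewrite E.
  apply lucas_bound_circle; [exact H|lra].
Qed.

(** If [u] is a zero then [v = 1 / u] is one of the two reciprocal roots; with
    [y] the other one, [lucas (n+1) - y * lucas n = v^(n+1)] grows
    geometrically, against [lucas_growth_closed_disk]. *)
Lemma divided_difference_neq_0 T a b l u : dieudonne_condition T a b ->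
  Cmod l <= 1 -> l <> RtoC 1 -> Cmod u < 1 -> divided_difference T a b l u <> RtoC 0.
Proof.
intros H Hl Hl1 Hu E.
destruct (lucas_growth_closed_disk T a b l H Hl Hl1) as [K [HK0 HK]].
assert (Hu0 : u <> RtoC 0).
{ intros ->. unfold divided_difference in E.
  apply (f_equal Re) in E.
  replace (1 + RtoC a * geom T l * 0 + RtoC b * geom (2 * T) l * 0 ^ 2)%C
    with (RtoC 1) in E by ring. simpl in E. lra. }
set (s := reciprocal_roots_sum T a l) in *. set (p := reciprocal_roots_prod T b l) in *.
set (v := (/ u)%C). set (y := (s - v)%C).
assert (Hs : s = (v + y)%C) by (unfold y; ring).
assert (Hp : p = (v * y)%C).
{ unfold y. replace (v * (s - v))%C
    with (p - / u ^ 2 * divided_difference T a b l u)%C.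
  - rewrite E. ring.
  - unfold divided_difference, v, s, p, reciprocal_roots_sum, reciprocal_roots_prod. rewrite RtoC_opp.
    field. exact Hu0. }
rewrite Hs, Hp in HK.
assert (Hy0 := Cmod_ge_0 y).
apply (geometric_beats_linear (Cmod v) (K * (1 + Cmod y))).
- unfold v. rewrite Cmod_inv by exact Hu0. rewrite <- Rinv_1.
  apply Rinv_lt_contravar; [|exact Hu]. apply Cmod_gt_0 in Hu0. lra.
- intros n. rewrite <- Cmod_pow, <- (lucas_step v y n).
  unfold Cminus. eapply Rle_trans; [apply Cmod_triangle|].
  rewrite Cmod_opp, Cmod_mult.
  assert (B1 := HK (S n)). assert (B2 := HK n). rewrite S_INR in B1.
  assert (Hn := pos_INR n). nra.
Qed.

(** Of two points with the same image, one of least modulus is [l * z]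
    with [|l| <= 1], where [z] is the other one; then [z^T] is a zero of the
    divided difference. *)
Lemma dieudonne_univalent T a b : (1 <= T)%nat ->
  dieudonne_condition T a b -> U T (a, b).
Proof.
intros HT H. split; simpl.
{ intros z _. apply ex_derive_trinomial. }
assert (W : forall z w, Cmod z < 1 -> Cmod w <= Cmod z ->
  trinomial T a b z = trinomial T a b w -> z = w).
{ intros z w Hz Hwz E.
  destruct (Ceq_dec z 0) as [->|Hz0].
  { rewrite Cmod_0 in Hwz. symmetry. apply Cmod_eq_0.
    generalize (Cmod_ge_0 w); lra. }
  destruct (Ceq_dec z w) as [|Hne]; [assumption|exfalso].
  set (l := (w / z)%C).
  assert (Hw : w = (l * z)%C) by (unfold l; field; exact Hz0).
  assert (Hl1 : l <> RtoC 1) by (intros El; apply Hne; rewrite Hw, El; ring).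
  assert (Hz0' := proj1 (Cmod_gt_0 z) Hz0).
  apply (divided_difference_neq_0 T a b l (z ^ T)%C H); [|exact Hl1| |].
  - unfold l. rewrite Cmod_div by exact Hz0.
    apply (Rmult_le_reg_r (Cmod z)); [exact Hz0'|].
    unfold Rdiv. rewrite Rmult_assoc, Rinv_l by lra. lra.
  - rewrite Cmod_pow. apply pow_lt_1_compat; [lra|lia].
  - apply (Cmult_eq_0_reg_l (z * (1 - l))%C).
    + intros E0. apply Cmult_eq_0_reg_l in E0; [|exact Hz0].
      apply Hl1. replace l with (1 - (1 - l))%C by ring. rewrite E0. ring.
    + rewrite <- trinomial_minus_scaled, <- Hw, E. ring. }
intros z w Hz Hw E. unfold unit_disk in *.
destruct (Rle_lt_dec (Cmod w) (Cmod z)) as [Hc|Hc]; [now apply W|].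
symmetry. apply W; [exact Hw|lra|now symmetry].
Qed.

(** * The corner of the region of univalence *)

Lemma abs_sin_mult_le n x : Rabs (sin (INR n * x)) <= INR n * Rabs (sin x).
Proof.
induction n as [|n IH].
- simpl. rewrite Rmult_0_l, sin_0, Rabs_R0. lra.
- rewrite S_INR. replace ((INR n + 1) * x) with (INR n * x + x) by ring.
  rewrite sin_plus. eapply Rle_trans; [apply Rabs_triang|]. rewrite !Rabs_mult.
  assert (C : forall y, Rabs (cos y) <= 1).
  { intros y. apply Rabs_le. apply COS_bound. }
  assert (C1 := C x). assert (C2 := C (INR n * x)).
  assert (0 <= Rabs (sin x)) by apply Rabs_pos.
  assert (0 <= Rabs (sin (INR n * x))) by apply Rabs_pos.
  assert (0 <= Rabs (cos x)) by apply Rabs_pos. nra.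
Qed.

Lemma sin_cos_shift j x :
  sin (x + INR j * PI) = (-1) ^ j * sin x /\ cos (x + INR j * PI) = (-1) ^ j * cos x.
Proof.
induction j as [|j [IH1 IH2]].
- simpl. rewrite Rmult_0_l, Rplus_0_r. lra.
- rewrite S_INR. replace (x + (INR j + 1) * PI) with (x + INR j * PI + PI) by ring.
  rewrite neg_sin, neg_cos, IH1, IH2. simpl. lra.
Qed.

(** With [t = al + x], [al] a midpoint between consecutive zeros of [sin (m t)]
    and [m = T + 1], the function is the quotient of
    [T sin t + sin (m t) cos (T t)] by [|sin (m t)|].  Its derivative has the
    sign of [sin (m x)], since the last factor will turn out to be nonnegative. *)
Lemma cell_quotient_derivative (m al x : R) : cos (m * x) <> 0 ->
  is_derive (fun y => (m - 1) * sin (al + y) / cos (m * y) + sin (al - (m - 1) * y)) x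
    ((m - 1) * sin (m * x) / cos (m * x) ^ 2
      * ((m - 1) * sin (al + x) + sin (m * x) * cos (al - (m - 1) * x))).
Proof.
intros Hc. auto_derive; [exact Hc|].
change (al + - ((m - 1) * x)) with (al - (m - 1) * x).
replace (al - (m - 1) * x) with (al + x - m * x) by ring.
rewrite cos_minus. generalize (sin2_cos2 (m * x)). unfold Rsqr. intros H.
set (Z := sin (m * x)) in *. set (c := cos (m * x)) in *.
set (s := sin (al + x)). set (k := cos (al + x)).
assert (HZ2 : Z ^ 2 = 1 - c ^ 2) by (simpl; lra).
assert (HZ3 : Z ^ 3 = Z * (1 - c ^ 2)) by (rewrite <- HZ2; ring).
apply (Rmult_eq_reg_r (c ^ 2)); [|now apply pow_nonzero].
field_simplify; [|exact Hc|exact Hc].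
rewrite HZ2, HZ3. ring.
Qed.

Lemma sin_odd_mult_le (T : nat) x : 0 <= sin x ->
  sin ((1 + 2 * INR T) * x) <= (1 + 2 * INR T) * sin x.
Proof.
intros Hx. assert (H := abs_sin_mult_le (S (2 * T)) x).
rewrite S_INR, mult_INR, (Rabs_pos_eq (sin x)) in H by exact Hx.
replace (INR 2 * INR T + 1) with (1 + 2 * INR T) in H by (simpl; ring).
apply Rabs_le_between in H. lra.
Qed.

(** The quotient of [cell_quotient_derivative] has its minimum at [x = 0].  The
    last factor of the derivative is half of
    [(2T+1) sin t - sin ((2T+1) t)] for [t = al + y]. *)
Lemma sin_midpoint_le (T j : nat) x : (j <= T)%nat ->
  let m := INR T + 1 in
  let al := (2 * INR j + 1) * PI / (2 * m) in
  - (PI / 2) < m * x < PI / 2 ->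
  m * sin al * cos (m * x) <=
  INR T * sin (al + x) + cos (m * x) * sin (al - INR T * x).
Proof.
intros Hj m al Hx.
assert (HPI := PI_RGT_0). assert (HT := pos_INR T). assert (Hj0 := pos_INR j).
assert (Hm : 1 <= m) by (unfold m; lra).
assert (Hjm : INR j + 1 <= m) by (apply le_INR in Hj; unfold m; lra).
assert (Hal : m * al = INR j * PI + PI / 2) by (unfold al; field; lra).
set (G := fun y => (m - 1) * sin (al + y) / cos (m * y) + sin (al - (m - 1) * y)).
assert (Hcos : forall y, Rmin 0 x <= y <= Rmax 0 x -> 0 < cos (m * y)).
{ intros y Hy. apply cos_gt_0; revert Hy; unfold Rmin, Rmax; destruct (Rle_dec 0 x); nra. }
destruct (MVT_gen G 0 x (fun y => (m - 1) * sin (m * y) / cos (m * y) ^ 2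
      * ((m - 1) * sin (al + y) + sin (m * y) * cos (al - (m - 1) * y)))) as [y [Hy E]].
{ intros y Hy. apply cell_quotient_derivative. apply Rgt_not_eq, Hcos. lra. }
{ intros y Hy. apply derivable_continuous_pt.
  exists ((m - 1) * sin (m * y) / cos (m * y) ^ 2
      * ((m - 1) * sin (al + y) + sin (m * y) * cos (al - (m - 1) * y))).
  apply is_derive_Reals, cell_quotient_derivative. apply Rgt_not_eq, Hcos. lra. }
assert (HG : G 0 <= G x).
{ assert (Hc := Hcos y Hy).
  assert (Hbr : 0 <= (m - 1) * sin (al + y) + sin (m * y) * cos (al - (m - 1) * y)).
  { assert (Hs : 0 <= sin (al + y)).
    { assert (- (PI / 2) < m * y < PI / 2).
      { revert Hy; unfold Rmin, Rmax; destruct (Rle_dec 0 x); nra. }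
      apply sin_ge_0; apply (Rmult_le_reg_l m); nra. }
    assert (D := sin_odd_mult_le T (al + y) Hs).
    assert (Hp : sin ((1 + 2 * INR T) * (al + y)) =
      sin (al + y) - 2 * (sin (m * y) * cos (al - (m - 1) * y))).
    { replace ((1 + 2 * INR T) * (al + y))
        with (2 * (m * y) - (al + y) + PI + 2 * INR j * PI)
        by (replace ((1 + 2 * INR T) * (al + y)) with (2 * (m * al) + 2 * (m * y) - (al + y))
              by (unfold m; ring); rewrite Hal; field).
      rewrite sin_period, neg_sin.
      replace (2 * (m * y) - (al + y)) with (m * y - (al - (m - 1) * y)) by ring.
      replace (al + y) with (m * y + (al - (m - 1) * y)) by ring.
      rewrite (sin_minus (m * y)), (sin_plus (m * y)). ring. }
    rewrite Hp in D.
    replace (1 + 2 * INR T) with (2 * (m - 1) + 1) in D by (unfold m; ring). lra. }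
  assert (Hsx : 0 <= sin (m * y) * x).
  { revert Hy; unfold Rmin, Rmax; destruct (Rle_dec 0 x); intros Hy.
    - apply Rmult_le_pos; [apply sin_ge_0; nra|lra].
    - assert (0 <= sin (- (m * y))) by (apply sin_ge_0; nra).
      rewrite sin_neg in *. nra. }
  assert (0 <= G x - G 0); [|lra].
  rewrite E, Rminus_0_r.
  match goal with |- 0 <= ?d * ?b * x =>
    replace (d * b * x) with ((m - 1) * / cos (m * y) ^ 2 * b * (sin (m * y) * x))
      by (field; lra) end.
  assert (0 < / cos (m * y) ^ 2) by (apply Rinv_0_lt_compat, pow_lt; lra).
  apply Rmult_le_pos; [|exact Hsx]. apply Rmult_le_pos; [|exact Hbr].
  apply Rmult_le_pos; lra. }
assert (Hc : 0 < cos (m * x)) by (apply cos_gt_0; lra).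
unfold G in HG. rewrite !Rmult_0_r, Rplus_0_r, Rminus_0_r, cos_0 in HG.
replace (m - 1) with (INR T) in HG by (unfold m; ring).
apply (Rmult_le_compat_r (cos (m * x))) in HG; [|lra].
replace ((INR T * sin (al + x) / cos (m * x) + sin (al - INR T * x)) * cos (m * x))
  with (INR T * sin (al + x) + cos (m * x) * sin (al - INR T * x)) in HG by (field; lra).
unfold m at 1. lra.
Qed.

Lemma exists_cell (T : nat) t : 0 < t < PI -> exists j, (j <= T)%nat /\
  INR j * PI <= (INR T + 1) * t < (INR j + 1) * PI.
Proof.
intros Ht. assert (HPI := PI_RGT_0). assert (HT := pos_INR T).
destruct (nfloor_ex ((INR T + 1) * t / PI)) as [j [H1 H2]].
{ apply Rmult_le_pos; [nra|]. left. now apply Rinv_0_lt_compat. }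
assert (E : (INR T + 1) * t / PI * PI = (INR T + 1) * t) by (field; lra).
exists j.
assert (B1 : INR j * PI <= (INR T + 1) * t) by nra.
assert (B2 : (INR T + 1) * t < (INR j + 1) * PI) by nra.
split; [|lra].
assert (INR j < INR (S T)) by (rewrite S_INR; nra).
apply INR_lt in H. lia.
Qed.

(** With [t = al + x] in the cell of midpoint [al], one has
    [sin (m t) = (-1)^j cos (m x)] and
    [sin (m t) cos (T t) = cos (m x) sin (al - T x)], so [sin_midpoint_le]
    gives the inequality with [sin al] in place of [sin (PI / (2 m))].  The
    latter is smaller, as [PI / (2 m)] is the midpoint nearest to 0. *)
Lemma corner_inequality (T : nat) t : 0 < t < PI ->
  (INR T + 1) * sin (PI / (2 * (INR T + 1))) * Rabs (sin ((INR T + 1) * t)) <=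
  INR T * sin t + sin ((INR T + 1) * t) * cos (INR T * t).
Proof.
intros Ht. assert (HPI := PI_RGT_0). assert (HT := pos_INR T).
set (m := INR T + 1). assert (Hm : 1 <= m) by (unfold m; lra).
assert (Hst : 0 <= sin t) by (apply sin_ge_0; lra).
destruct (Req_dec (sin (m * t)) 0) as [E0|E0].
{ rewrite E0, Rabs_R0. nra. }
destruct (exists_cell T t Ht) as [j [Hj Hcell]]. fold m in Hcell.
assert (Hj0 := pos_INR j).
assert (Hjm : INR j + 1 <= m) by (apply le_INR in Hj; unfold m; lra).
set (al := (2 * INR j + 1) * PI / (2 * m)). set (x := t - al).
assert (Hmx : m * x = m * t - INR j * PI - PI / 2) by (unfold x, al; field; lra).
destruct (sin_cos_shift j (m * x + PI / 2)) as [S1 _].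
destruct (sin_cos_shift j (m * x - t + PI / 2)) as [_ S2].
replace (m * x + PI / 2 + INR j * PI) with (m * t) in S1 by (rewrite Hmx; ring).
replace (m * x - t + PI / 2 + INR j * PI) with (INR T * t) in S2
  by (rewrite Hmx; unfold m; ring).
replace (m * x + PI / 2) with (PI / 2 - - (m * x)) in S1 by ring.
rewrite sin_shift, cos_neg in S1.
replace (m * x - t + PI / 2) with (PI / 2 - (t - m * x)) in S2 by ring.
rewrite cos_shift in S2.
replace (t - m * x) with (al - INR T * x) in S2 by (unfold m, x; ring).
assert (He : (-1) ^ j * (-1) ^ j = 1).
{ rewrite <- Rpow_mult_distr. replace (-1 * -1) with 1 by ring. apply pow1. }
assert (Hx : - (PI / 2) < m * x < PI / 2).
{ split; [|lra]. destruct (Req_dec (m * x) (- (PI / 2))) as [E|E]; [|lra].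
  exfalso. apply E0. rewrite S1, E, cos_neg, cos_PI2. ring. }
assert (Hc : 0 < cos (m * x)) by (apply cos_gt_0; lra).
rewrite S2, S1, Rabs_mult, pow_1_abs, (Rabs_pos_eq (cos (m * x))) by lra.
assert (M := sin_midpoint_le T j x Hj). simpl in M. fold m al in M. specialize (M Hx).
replace (al + x) with t in M by (unfold x; ring).
replace ((-1) ^ j * cos (m * x) * ((-1) ^ j * sin (al - INR T * x)))
  with ((-1) ^ j * (-1) ^ j * (cos (m * x) * sin (al - INR T * x))) by ring.
rewrite He, !Rmult_1_l.
eapply Rle_trans; [|exact M].
apply Rmult_le_compat_r; [lra|]. apply Rmult_le_compat_l; [lra|].
assert (Hal : m * al = INR j * PI + PI / 2) by (unfold al; field; lra).
assert (H0 : m * (PI / (2 * m)) = PI / 2) by (field; lra).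
assert (A1 : PI / (2 * m) <= al) by (apply (Rmult_le_reg_l m); nra).
assert (A2 : al <= PI - PI / (2 * m)) by (apply (Rmult_le_reg_l m); nra).
assert (A0 : 0 <= PI / (2 * m)) by (apply (Rmult_le_reg_l m); nra).
destruct (Rle_lt_dec al (PI / 2)) as [Hq|Hq].
- apply sin_incr_1; lra.
- rewrite <- (sin_PI_x al). apply sin_incr_1; lra.
Qed.

Lemma corner_angle_facts T : (1 <= T)%nat ->
  let t := PI / (2 + 2 * INR T) in
  0 < t < PI / 2 /\ (1 + INR T) * t = PI / 2 /\ 0 < sin t < 1 /\
  a0 T = sin t * (1 + b0 T) /\ 0 < b0 T.
Proof.
intros HT t. assert (HPI := PI_RGT_0). apply le_INR in HT. simpl in HT.
assert (E : (1 + INR T) * t = PI / 2) by (unfold t; field; lra).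
assert (0 < t < PI / 2) by (split; nra).
repeat split; try lra; try exact E.
- apply sin_gt_0; lra.
- rewrite <- sin_PI2. apply sin_increasing_1; lra.
- unfold a0, b0. fold t. field. lra.
- unfold b0. apply Rdiv_lt_0_compat; lra.
Qed.

(** After multiplication by [1 + 2 T] the second inequality is
    [corner_inequality], because
    [sin ((1 + 2T) t) + sin t = 2 sin ((1 + T) t) cos (T t)]. *)
Lemma corner_dieudonne T : (1 <= T)%nat -> dieudonne_condition T (a0 T) (b0 T).
Proof.
intros HT t Ht.
assert (HT0 := pos_INR T).
assert (Hs : 0 <= sin t) by (apply sin_ge_0; lra).
assert (D := abs_sin_mult_le (S (2 * T)) t).
rewrite S_INR, mult_INR, (Rabs_pos_eq (sin t)) in D by exact Hs.
replace (INR 2 * INR T + 1) with (1 + 2 * INR T) in D by (simpl; ring).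
assert (Hk : 0 < 1 + 2 * INR T) by lra.
split.
- unfold b0. rewrite Rabs_mult. unfold Rdiv. rewrite Rmult_1_l, Rabs_inv, Rabs_pos_eq by lra.
  apply (Rmult_le_reg_l (1 + 2 * INR T)); [lra|]. rewrite <- Rmult_assoc, Rinv_r by lra. lra.
- assert (C := corner_inequality T t Ht).
  replace (2 * (INR T + 1)) with (2 + 2 * INR T) in C by ring.
  rewrite (Rplus_comm (INR T) 1) in C.
  replace ((1 + 2 * INR T) * t) with ((1 + INR T) * t + INR T * t) by ring.
  assert (Hsum : sin ((1 + INR T) * t + INR T * t) + sin t =
    2 * (sin ((1 + INR T) * t) * cos (INR T * t))).
  { replace t with ((1 + INR T) * t - INR T * t) at 3 by ring.
    rewrite sin_plus, sin_minus. ring. }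
  apply (Rmult_le_reg_l (1 + 2 * INR T)); [lra|].
  assert (Hsp : 0 <= sin (PI / (2 + 2 * INR T))).
  { assert (HPI := PI_RGT_0). apply sin_ge_0.
    - apply Rmult_le_pos; [lra|]. left. apply Rinv_0_lt_compat. lra.
    - apply (Rmult_le_reg_r (2 + 2 * INR T)); [lra|].
      unfold Rdiv. rewrite Rmult_assoc, Rinv_l by lra. nra. }
  unfold a0, b0. rewrite Rabs_mult, Rabs_pos_eq.
  2:{ apply Rmult_le_pos; [|exact Hsp]. apply Rmult_le_pos; [lra|].
      apply Rmult_le_pos; [lra|]. left. now apply Rinv_0_lt_compat. }
  match goal with |- _ * (2 * _ * ?s * ?r) <= _ * (_ + _ * ?q) =>
    replace ((1 + 2 * INR T) * (2 * ((1 + INR T) / (1 + 2 * INR T)) * s * r))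
      with (2 * ((1 + INR T) * s * r)) by (field; lra);
    replace ((1 + 2 * INR T) * (sin t + 1 / (1 + 2 * INR T) * q))
      with (2 * INR T * sin t + (q + sin t)) by (field; lra) end.
  rewrite Hsum. lra.
Qed.

(** The limit [t -> 0] of the first inequality, in contrapositive form: if
    [|b| (1 + 2T) > 1] then [|b sin ((1 + 2T) t)| > t > sin t] for small [t]. *)
Lemma dieudonne_b_bound T a b : dieudonne_condition T a b -> Rabs b <= b0 T.
Proof.
intros H. apply Rnot_lt_le. intros Hb.
assert (HPI := PI_RGT_0). assert (HT := pos_INR T).
set (k := 1 + 2 * INR T) in *. assert (Hk : 1 <= k) by (unfold k; lra).
unfold b0 in Hb. fold k in Hb.
assert (Hbk : 1 < Rabs b * k).
{ apply (Rmult_lt_compat_r k) in Hb; [|lra]. replace (1 / k * k) with 1 in Hb by (field; lra).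
  exact Hb. }
assert (Hb0 : 0 < Rabs b) by nra.
assert (He : 0 < 1 - / (Rabs b * k)).
{ assert (/ (Rabs b * k) < / 1) by (apply Rinv_lt_contravar; lra). lra. }
destruct (derivable_pt_lim_sin 0 _ He) as [d Hd].
assert (Hdp := cond_pos d).
set (h := Rmin (d / 2) 1).
assert (Hh : 0 < h <= 1) by (unfold h, Rmin; destruct (Rle_dec (d / 2) 1); lra).
assert (Hhd : Rabs h < d).
{ rewrite Rabs_pos_eq by lra. unfold h, Rmin; destruct (Rle_dec (d / 2) 1); lra. }
specialize (Hd h (Rgt_not_eq _ _ (proj1 Hh)) Hhd).
rewrite Rplus_0_l, sin_0, cos_0, Rminus_0_r in Hd. apply Rabs_lt_between in Hd.
assert (Hsin : h < Rabs b * k * sin h).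
{ assert (/ (Rabs b * k) < sin h / h) by lra.
  replace h with (/ (Rabs b * k) * (Rabs b * k * h)) at 1 by (field; split; lra).
  replace (Rabs b * k * sin h) with (sin h / h * (Rabs b * k * h)) by (field; lra).
  apply Rmult_lt_compat_r; [|assumption]. nra. }
set (t := h / k).
assert (Hkt : k * t = h) by (unfold t; field; lra).
assert (Ht : 0 < t < PI) by (assert (H3 := PI2_1); split; nra).
destruct (H t Ht) as [H1 _]. fold k in H1. rewrite Hkt, Rabs_mult in H1.
assert (sin t < t) by (apply sin_lt_x; lra).
assert (sin h <= Rabs (sin h)) by apply Rle_abs.
nra.
Qed.

(** The second inequality at [t = PI / (2 + 2 T)], where
    [sin ((1 + T) t) = 1] and [sin ((1 + 2T) t) = sin t]. *)
Lemma dieudonne_a_bound T a b : (1 <= T)%nat -> dieudonne_condition T a b ->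
  Rabs a <= sin (PI / (2 + 2 * INR T)) * (1 + b).
Proof.
intros HT H. destruct (corner_angle_facts T HT) as [Ht [E _]].
set (t := PI / (2 + 2 * INR T)) in *.
destruct (H t) as [_ H2]; [lra|].
replace ((1 + 2 * INR T) * t) with (PI - t) in H2
  by (replace ((1 + 2 * INR T) * t) with (2 * ((1 + INR T) * t) - t) by ring; rewrite E; field).
rewrite E, sin_PI2, sin_PI_x, Rmult_1_r in H2. lra.
Qed.

Lemma corner_on_Gamma3 T : (1 <= T)%nat -> Gamma3_plus T (a0 T, b0 T).
Proof.
intros HT. destruct (corner_angle_facts T HT) as [Ht [E [Hs _]]].
assert (HT0 := le_INR _ _ HT). simpl in HT0.
exists (PI / (2 + 2 * INR T)).
unfold extend_at_0, Gamma3_A, Gamma3_B, Gamma3_den, a0, b0.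
set (t := PI / (2 + 2 * INR T)) in *.
split; [lra|].
destruct (Req_EM_T t 0) as [E0|_]; [lra|].
assert (Hc : 0 < cos t) by (apply cos_gt_0; lra).
assert (E1 : sin (INR T * t) = cos t).
{ replace (INR T * t) with (PI / 2 - t) by lra. apply sin_shift. }
assert (E2 : sin ((2 + 3 * INR T) * t) = - cos t).
{ replace ((2 + 3 * INR T) * t) with (INR T * t + PI) by lra. rewrite neg_sin. lra. }
assert (E3 : sin ((2 + 2 * INR T) * t) = 0).
{ replace ((2 + 2 * INR T) * t) with PI by lra. apply sin_PI. }
assert (E4 : sin (2 * INR T * t) = 2 * sin t * cos t).
{ replace (2 * INR T * t) with (PI - 2 * t) by lra. rewrite sin_PI_x. apply sin_2a. }
assert (E5 : sin ((2 + INR T) * t) = cos t).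
{ replace ((2 + INR T) * t) with (PI - INR T * t) by lra. now rewrite sin_PI_x. }
rewrite E1, E2, E3, E4, E5. f_equal; field; split; nra.
Qed.

Lemma quotient_min_of_slope_bound s a c : 0 < s < 1 -> 0 < c -> Rabs a <= s * c ->
  0 < c + a /\ (1 - s) / (1 + s) <= (c - a) / (c + a).
Proof.
intros Hs Hc Ha. apply Rabs_le_between in Ha.
assert (Hp : 0 < c + a) by nra. split; [exact Hp|].
apply (Rmult_le_reg_r ((1 + s) * (c + a))); [nra|].
replace ((1 - s) / (1 + s) * ((1 + s) * (c + a))) with ((1 - s) * (c + a)) by (field; lra).
replace ((c - a) / (c + a) * ((1 + s) * (c + a))) with ((c - a) * (1 + s)) by (field; lra).
nra.
Qed.

Theorem theorem1 : forall T : nat, (1 <= T)%nat ->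
  upper_right_corner T (a0 T, b0 T) /\
  attains_max_at (U T) L1 (a0 T, b0 T) /\
  attains_max_at (U T) L2 (a0 T, b0 T) /\
  attains_min_at (U T) L3 (a0 T, b0 T).
Proof.
intros T HT.
destruct (corner_angle_facts T HT) as [Ht [E [Hs [Ha0 Hb0]]]].
set (s := sin (PI / (2 + 2 * INR T))) in *.
assert (HC : U T (a0 T, b0 T)) by (apply dieudonne_univalent, corner_dieudonne; exact HT).
assert (HU : forall a b, U T (a, b) -> Rabs b <= b0 T /\ Rabs a <= s * (1 + b)).
{ intros a b H. apply univalent_dieudonne in H; [|exact HT]. split.
  - exact (dieudonne_b_bound T a b H).
  - exact (dieudonne_a_bound T a b HT H). }
assert (Hb01 : b0 T < 1).
{ apply le_INR in HT. simpl in HT. unfold b0.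
  apply (Rmult_lt_reg_r (1 + 2 * INR T)); [lra|].
  replace (1 / (1 + 2 * INR T) * (1 + 2 * INR T)) with 1 by (field; lra). lra. }
assert (Hmax : forall a b, U T (a, b) -> a <= a0 T /\ b <= b0 T).
{ intros a b H. destruct (HU a b H) as [H1 H2].
  apply Rabs_le_between in H1. assert (H3 := Rle_abs a). split; [|lra].
  rewrite Ha0. nra. }
split; [|split; [|split]].
- split; [|split].
  + intros eps. assert (He := cond_pos eps). split.
    * exists (a0 T, b0 T). split; [apply ball_center|exact HC].
    * exists (a0 T, b0 T + eps / 2). split.
      -- split; [apply ball_center|]. change (Rabs (b0 T + eps / 2 - b0 T) < eps).
         rewrite Rabs_pos_eq; lra.
      -- intros H. destruct (Hmax _ _ H). lra.
  + exists (a0 T). split; [|reflexivity].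
    rewrite Rabs_pos_eq; [lra|]. rewrite Ha0. nra.
  + exact (corner_on_Gamma3 T HT).
- split; [exact HC|]. intros [a b] H. destruct (Hmax a b H). unfold L1; simpl. lra.
- split; [exact HC|]. intros [a b] H. destruct (Hmax a b H). unfold L2; simpl. lra.
- split; [exact HC|]. intros [a b] H. destruct (HU a b H) as [H1 H2].
  apply Rabs_le_between in H1.
  destruct (quotient_min_of_slope_bound s a (1 + b) Hs) as [Hp HL]; [lra|exact H2|].
  unfold L3; simpl.
  replace (1 - a + b) with (1 + b - a) by ring.
  replace (1 + a + b) with (1 + b + a) by ring.
  eapply Rle_trans; [|exact HL]. right. rewrite Ha0. field. split; nra.
Qed.
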